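(* Let $(X,d)$ be a compact metric space and let $(X,\mathbb{F})$ be the non-autonomous dynamical system generated by a commutative family $\mathbb{F}=\{f_n:n\in\mathbb{N}\}$ of homeomorphisms of $X$. If $x\in X$ is periodic of period $r\in\mathbb{N}$ for $(X,\mathbb{F})$, then every point of $\overline{\mathcal{O}_H(x)}$ is periodic of the same period $r$.
   Context: $\mathbb{N}=\{1,2,3,\dots\}$. The family $\mathbb{F}$ is commutative if $f_n\circ f_m=f_m\circ f_n$ for all $n,m$. The non-autonomous system $(X,\mathbb{F})$ has time-$n$ states $\omega_n(x)$, $n\in\mathbb{Z}$, defined by $\omega_0(x)=x$, $\omega_n(x)=f_n(\omega_{n-1}(x))$ for $n\ge 1$, and $\omega_n(x)=f_{-n}^{-1}(\omega_{n+1}(x))$ for $n<0$; thus $\omega_n=f_n\circ\cdots\circ f_1$ and $\omega_{-n}=f_n^{-1}\circ\cdots\circ f_1^{-1}$ for $n\geq 1$. The orbital hull of $x$ is $\mathcal{O}_H(x)=\{(\omega_{k_n}\circ\omega_{k_{n-1}}\circ\cdots\circ\omega_{k_1})(x): k_i\in\mathbb{Z},\ n\in\mathbb{N}\}$. A point $x$ is periodic of period $n\in\mathbb{N}$ if $\omega_{nk}(x)=x$ for all $k\in\mathbb{Z}$ (minimality of $n$ is not required). *)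

(* Defs.v *)
From mathcomp Require Import all_boot all_order all_algebra.
From mathcomp Require Import all_classical reals topology.

Set Implicit Arguments.
Unset Strict Implicit.
Unset Printing Implicit Defensive.

Import GRing.Theory.

Local Open Scope classical_set_scope.

Record homeomorphism (X : topologicalType) := Homeomorphism {
  homeo_fun :> X -> X;
  homeo_inv : X -> X;
  homeo_funK : cancel homeo_fun homeo_inv;
  homeo_invK : cancel homeo_inv homeo_fun;
  homeo_fun_continuous : continuous homeo_fun;
  homeo_inv_continuous : continuous homeo_inv
}.

(* A family f_1, f_2, ... is encoded as f : nat -> homeomorphism X, where
   f n is f_n for 0 < n; the value f 0 is never used. *)

Definition commutative_family (X : topologicalType)
    (f : nat -> homeomorphism X) : Prop :=
  forall n m : nat, (0 < n)%N -> (0 < m)%N -> f n \o f m =1 f m \o f n.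

Fixpoint omega_forward (X : topologicalType) (f : nat -> homeomorphism X)
    (n : nat) (x : X) : X :=
  if n is m.+1 then f n (omega_forward f m x) else x.

Fixpoint omega_backward (X : topologicalType) (f : nat -> homeomorphism X)
    (n : nat) (x : X) : X :=
  if n is m.+1 then homeo_inv (f n) (omega_backward f m x) else x.

(* Negz m is the integer - m.+1. Unless f is commutative, omega f (- k) need not
   be the inverse of omega f k. *)
Definition omega (X : topologicalType) (f : nat -> homeomorphism X)
    (k : int) (x : X) : X :=
  match k with
  | Posz n => omega_forward f n x
  | Negz m => omega_backward f m.+1 x
  end.

Lemma omega_0 (X : topologicalType) (f : nat -> homeomorphism X) (x : X) :
  omega f 0%R x = x.
Proof. by []. Qed.

Lemma omega_gt0 (X : topologicalType) (f : nat -> homeomorphism X)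
    (n : nat) (x : X) : (0 < n)%N ->
  omega f n%:Z x = f n (omega f (n%:Z - 1)%R x).
Proof.
case: n => // n _; have -> // : (n.+1%:Z - 1 = n%:Z)%R.
by rewrite intS addrAC subrr add0r.
Qed.

Lemma omega_lt0 (X : topologicalType) (f : nat -> homeomorphism X)
    (n : nat) (x : X) : (0 < n)%N ->
  omega f (- n%:Z)%R x = homeo_inv (f n) (omega f (- n%:Z + 1)%R x).
Proof.
case: n => // -[|n] // _; have -> // : (- n.+2%:Z + 1 = - n.+1%:Z)%R.
by rewrite (intS n.+1) opprD addrAC addNr add0r.
Qed.

(* For ks = [:: k_1; ...; k_n], foldl applies omega f k_1 first. *)
Definition orbital_hull (X : topologicalType) (f : nat -> homeomorphism X)
    (x : X) : set X :=
  [set y | exists2 ks : seq int, (0 < size ks)%N &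
             y = foldl (fun z k => omega f k z) x ks].

Definition periodic (X : topologicalType) (f : nat -> homeomorphism X)
    (r : nat) (x : X) : Prop :=
  forall k : int, omega f (r%:Z * k)%R x = x.

(* Main.v *)
Require Import Defs.
From mathcomp Require Import all_boot all_order all_algebra.
From mathcomp Require Import all_classical reals topology.

(** Commutativity of the family passes to inverses, so all the [omega f k] commute ([omega_omegaC]).
    Hence each [omega f j] maps fixed points of [omega f (r * k)] to fixed points, which carries
    periodicity along the hull ([periodic_orbital_hull]). For each [k] these fixed points form a
    closed set ([closed_fixpoints]), which thus contains the closure of the hull. *)

(** Keeping [g] arbitrary allows two uses in [omega_omegaC]: with [g] some [f n], then with [g] some
    [omega f j]. *)
Lemma omega_commute (X : topologicalType) (f : nat -> homeomorphism X)
    (g : X -> X) (k : int) :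
  (forall n, (0 < n)%N -> g \o f n =1 f n \o g) ->
  g \o omega f k =1 omega f k \o g.
Proof.
move=> gf x; case: k => n; first by elim: n => //= n <-; exact: gf.
(* Moving the inverse across turns the goal into [f m.+1 (g (homeo_inv (f m.+1) z)) = g z]. *)
rewrite /omega; elim: n.+1 => [//|m /= <-]; apply: (canRL (homeo_funK _)).
by rewrite -[LHS]gf //= homeo_invK.
Qed.

Lemma omega_omegaC (X : topologicalType) (f : nat -> homeomorphism X)
    (j k : int) : commutative_family f ->
  omega f j \o omega f k =1 omega f k \o omega f j.
Proof.
move=> fC; apply: omega_commute => n n0 x.
by rewrite [RHS]omega_commute // => m m0 y; exact: fC.
Qed.

Lemma omega_continuous (X : topologicalType) (f : nat -> homeomorphism X)
    (k : int) : continuous (omega f k).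
Proof.
case: k => n; rewrite /omega.
  elim: n => [|n IHn] x; first exact: cvg_id.
  exact: continuous_comp (IHn x) (@homeo_fun_continuous _ (f n.+1) _).
elim: n.+1 => [|m IHm] x; first exact: cvg_id.
exact: continuous_comp (IHm x) (@homeo_inv_continuous _ (f m.+1) _).
Qed.

Lemma periodic_orbital_hull (X : topologicalType)
    (f : nat -> homeomorphism X) (r : nat) (x : X) :
  commutative_family f -> periodic f r x ->
  forall y, orbital_hull f x y -> periodic f r y.
Proof.
move=> fC px _ [ks _ ->] k; elim: ks x px => [|j ks IHks] x px; first exact: px.
(* The new base point [omega f j x] is periodic: swap the two maps, then use [px]. *)
by apply: IHks => i; rewrite [LHS](omega_omegaC _ f _ j fC) /= px.
Qed.

Lemma closed_fixpoints (X : topologicalType) (g : X -> X) :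
  hausdorff_space X -> continuous g -> closed [set x | g x = x]%classic.
Proof.
move=> hX cg x clx; apply: hX => A B Agx Bx.
have Ax : nbhs x (g @^-1` A)%classic by exact: cg.
(* A fixed point [z] near [x] has [z = g z] in both [A] and [B], so [g x] and [x] cannot be
   separated. *)
have [z [/= gz [Az Bz]]] := clx _ (filterI Ax Bx).
by exists z; split=> //; rewrite -gz.
Qed.

Theorem proposition1 (R : realType) (X : metricType R)
    (f : nat -> homeomorphism X) (r : nat) (x : X) :
  compact [set: X]%classic ->
  commutative_family f ->
  (0 < r)%N ->
  periodic f r x ->
  forall y : X, closure (orbital_hull f x) y -> periodic f r y.
Proof.
move=> _ fC _ px y cly k.
apply: (closed_fixpoints X _ (@metric_hausdorff R X) (omega_continuous X f _)).
by apply: closure_subset cly => z hz; exact: (periodic_orbital_hull _ _ _ _ fC px _ hz k).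
Qed.
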